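(* Let $\mathcal{I}$ be either $\mathcal{N}$ or $\mathcal{M}$. Then $$\mathrm{sc}(\{f\in\mathbb{R}^{\mathbb{R}}: f\text{ is }\mathcal{B}_{\mathcal{I}}\text{-measurable}\})\ \ge\ [\mathrm{cf}(\mathrm{non}(\mathcal{I}))]^{+}\ \ge\ [\mathrm{add}(\mathcal{I})]^{+}\ \ge\ \omega_2.$$
   Context: $\mathcal{N}$ is the $\sigma$-ideal of Lebesgue nullsets of $\mathbb{R}$ and $\mathcal{M}$ is the $\sigma$-ideal of first category (meager) subsets of $\mathbb{R}$. For $\mathcal{I}\in\{\mathcal{N},\mathcal{M}\}$, $\mathcal{B}_{\mathcal{I}}$ is the $\sigma$-algebra generated by the Borel sets and $\mathcal{I}$ (so $\mathcal{B}_{\mathcal{I}}$-measurable means Lebesgue measurable, respectively having the Baire property). $\mathrm{add}(\mathcal{I})=\min\{|\mathcal{A}|:\mathcal{A}\subset\mathcal{I},\ \bigcup\mathcal{A}\notin\mathcal{I}\}$ and $\mathrm{non}(\mathcal{I})=\min\{|A|:A\subset\mathbb{R},\ A\notin\mathcal{I}\}$. $\mathrm{cf}(\kappa)$ is the cofinality and $\kappa^+$ the successor cardinal of $\kappa$. $\mathbb{R}^{\mathbb{R}}$ is the set of all functions $f:\mathbb{R}\to\mathbb{R}$. A difference operator is a map $D:\mathbb{R}^{\mathbb{R}}\to\mathbb{R}^{\mathbb{R}}$ of the form $(Df)(x)=\sum_{i=1}^n a_i f(x+b_i)$ with $a_i,b_i\in\mathbb{R}$; $\mathcal{D}$ is the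 set of difference operators. A system of difference equations is a set $S\subset\mathcal{D}\times\mathbb{R}^{\mathbb{R}}$; a function $f:\mathbb{R}\to\mathbb{R}$ is a solution to $S$ if $Df=g$ for every $(D,g)\in S$. A subsystem of $S$ is a subset of $S$. For $\mathcal{F}\subset\mathbb{R}^{\mathbb{R}}$ the solvability cardinal $\mathrm{sc}(\mathcal{F})$ is the minimal cardinal $\kappa$ with the following property: for every system $S$ of difference equations, if every subsystem of $S$ of cardinality less than $\kappa$ has a solution in $\mathcal{F}$, then $S$ has a solution in $\mathcal{F}$. *)

(* Defs.v *)
From mathcomp Require Import all_boot all_order all_algebra.
From mathcomp Require Import all_classical all_reals all_analysis.
From mathcomp Require wochoice.

Set Implicit Arguments.
Unset Strict Implicit.
Unset Printing Implicit Defensive.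
Import Order.TTheory GRing.Theory Num.Theory.
Import numFieldNormedType.Exports.
Local Open Scope classical_set_scope.
Local Open Scope card_scope.
Local Open Scope ring_scope.

(* A cardinal is represented by any type having that cardinality; cardinals are
   compared by [#<=], so equipotent types represent the same cardinal. *)
Definition cardinal := Type.

Definition card_lt (T U : Type) (A : set T) (B : set U) : Prop :=
  A #<= B /\ ~ (B #<= A).
Notation "A '#<' B" := (card_lt A B)
  (at level 79, format "A  '#<'  B") : card_scope.

Definition is_min_card (P : cardinal -> Prop) (K : cardinal) : Prop :=
  P K /\ forall L : cardinal, P L -> [set: K] #<= [set: L].

(* The default value [void] is taken only if no cardinal satisfies [P] at all,
   see [min_cardP]. *)
Definition min_card (P : cardinal -> Prop) : cardinal :=
  match pselect (exists K, is_min_card P K) with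
  | left h => projT1 (cid h)
  | right _ => void
  end.

Lemma card_le_fun T U (A : set T) (B : set U) (f : T -> U) :
  set_fun A B f -> set_inj A f -> A #<= B.
Proof.
move=> fAB fI; have /injfunPex[g] : exists2 f, set_fun A B f & set_inj A f.
  by exists f.
exact: inj_card_le g.
Qed.

Lemma card_leT_fun (K L : Type) : [set: K] #<= [set: L] ->
  exists f : K -> L, injective f.
Proof.
move=> /card_leP[f]; exists (fun x => val (f (to_setT x))) => x y /val_inj.
by move=> /(@inj _ _ _ f); rewrite !inE => /(_ I I) [].
Qed.

(* In a nonempty family of sets there is one of least cardinality (Zorn's
   lemma on partial families of pairwise disagreeing choice functions). *)
Lemma card_least (T : Type) (J : set (set T)) : J !=set0 ->
  exists2 A, J A & forall B, J B -> A #<= B.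
Proof.
move=> [A0 JA0].
pose ok (F : set (set T -> T)) :=
  (forall g A, F g -> J A -> A (g A)) /\
  (forall g h A, F g -> F h -> J A -> g A = h A -> g = h).
have [F FF|F [[okF okinj] maxF]] := @Zorn_bigcup _ ok.
  move=> totF; split=> [g A [X FX Xg] JA|g h A [X FX Xg] [Y FY Yh] JA gh].
    exact: ((FF _ FX).1 g A Xg JA).
  have [XY|YX] := totF _ _ FX FY.
    exact: ((FF _ FY).2 g h A (XY _ Xg) Yh JA gh).
  exact: ((FF _ FX).2 g h A Xg (YX _ Yh) JA gh).
have [[A JA surjA]|nsurj] :=
  pselect (exists2 A, J A & forall x, A x -> exists2 g, F g & g A = x).
  exists A => // B JB.
  have /choice[s sP] (x : T) : exists g, A x -> F g /\ g A = x.
    have [Ax|nAx] := pselect (A x); last by exists (fun=> x).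
    by have [g Fg gA] := surjA _ Ax; exists g.
  apply: (@card_le_fun _ _ _ _ (fun x => s x B)).
    by move=> x Ax; have [Fs _] := sP _ Ax; exact: okF _ _ Fs JB.
  move=> x y /set_mem Ax /set_mem Ay sxy.
  have [Fx ex] := sP _ Ax; have [Fy ey] := sP _ Ay.
  by rewrite -ex -ey (okinj _ _ _ Fx Fy JB sxy).
have missed A : J A -> exists2 x, A x & forall g, F g -> g A <> x.
  move=> JA; apply: contrapT => H; apply: nsurj; exists A => // x Ax.
  apply: contrapT => H'; apply: H; exists x => // g Fg gA.
  by apply: H'; exists g.
have [x0 _ _] := missed _ JA0.
have /choice[g gP] (A : set T) :
    exists x, J A -> A x /\ forall g, F g -> g A <> x.
  have [JA|nJA] := pselect (J A); last by exists x0.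
  by have [x Ax xP] := missed _ JA; exists x.
exfalso; apply: (maxF (g |` F)).
  split; first by move=> h Fh; right.
  by move=> /(_ g (or_introl erefl)) Fg; exact: ((gP _ JA0).2 g Fg erefl).
split=> [h A [->|Fh] JA|h k A [->|Fh] [->|Fk] JA //].
- exact: ((gP _ JA).1).
- exact: okF _ _ Fh JA.
- by move=> /esym /((gP _ JA).2 _ Fk).
- by move=> /((gP _ JA).2 _ Fh).
- exact: (okinj _ _ A).
Qed.

Lemma card_le_total (K L : Type) : [set: K] #<= [set: L] \/ [set: L] #<= [set: K].
Proof.
pose J := [set range (@inl K L); range (@inr K L)].
have le1 : [set: K] #<= range (@inl K L).
  by apply: (@card_le_fun _ _ _ _ inl) => [x _|x y _ _ [//]]; exists x.
have le2 : [set: L] #<= range (@inr K L).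
  by apply: (@card_le_fun _ _ _ _ inr) => [x _|x y _ _ [//]]; exists x.
have [|A [->|->] Amin] := @card_least _ J; first by exists (range inl); left.
- left; apply: card_le_trans le1 (card_le_trans (Amin _ (or_intror erefl)) _).
  exact: card_image_le.
- right; apply: card_le_trans le2 (card_le_trans (Amin _ (or_introl erefl)) _).
  exact: card_image_le.
Qed.

Lemma min_cardP (P : cardinal -> Prop) :
  (forall K L : cardinal, [set: K] #= [set: L] -> P K -> P L) ->
  (exists K, P K) -> is_min_card P (min_card P).
Proof.
move=> Pext [K0 PK0]; rewrite /min_card; case: pselect => [h|]; last first.
  case; pose J := [set A : set K0 | P A].
  have eqT (A : set K0) : [set: A] #= A by exact: card_setT.
  have [|A JA Amin] := @card_least _ J.
    by exists setT; apply: Pext PK0; exact: card_setT_sym.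
  exists A; split=> // L PL.
  apply: (card_le_trans (B := A)); first by rewrite (card_le_eql (eqT A)).
  have [K0L|LK0] := card_le_total K0 L.
    apply: (card_le_trans (B := [set: K0])) K0L.
    by apply: (@card_le_fun _ _ _ _ id).
  have [f finj] := card_leT_fun LK0.
  have Lf : range f #= [set: L].
    rewrite card_eq_le card_image_le /=.
    by apply: (@card_le_fun _ _ _ _ f) => [x _|x y _ _ /finj//]; exists x.
  rewrite -(card_le_eqr Lf); apply: Amin; apply: Pext PL.
  by rewrite card_eq_sym (card_eql (eqT _)).
by case: cid.
Qed.

Definition succ_card (K : cardinal) : cardinal :=
  min_card (fun L => [set: K] #< [set: L]).

Definition omega2 : cardinal := succ_card (succ_card nat).

(* [R] well-orders [K] in the order type of the initial ordinal of [K]. *)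
Definition initial_well_order (K : cardinal) (R : rel K) : Prop :=
  wochoice.well_order R /\
  forall x : K, [set y | R y x /\ y <> x] #< [set: K].

Definition cofinal (K : Type) (R : rel K) (A : set K) : Prop :=
  forall x : K, exists2 y, A y & R x y.

Definition cofinality (K : cardinal) : cardinal :=
  min_card (fun L => exists (R : rel K) (A : set K),
    [/\ initial_well_order R, cofinal R A & A #= [set: L]]).

Section Ideals.
Variable R : realType.

Definition null_ideal : set (set R) := (@lebesgue_measure R).-negligible.

Definition nowhere_dense (A : set R) : Prop := (closure A)° = set0.

Definition meager_ideal : set (set R) :=
  [set A | exists F : nat -> set R,
    (forall n, nowhere_dense (F n)) /\ A `<=` \bigcup_n F n].

End Ideals.

Arguments null_ideal : clear implicits.
Arguments meager_ideal : clear implicits.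

Section IdealInvariants.
Variables (R : realType) (I : set (set R)).

Definition add_ideal : cardinal :=
  min_card (fun K => exists A : set (set R),
    [/\ A `<=` I, ~ I (\bigcup_(X in A) X) & A #= [set: K]]).

Definition non_ideal : cardinal :=
  min_card (fun K => exists A : set R, ~ I A /\ A #= [set: K]).

(* [measurable] on [R] is the Borel sigma-algebra. *)
Definition BI_generator : set (set R) := [set A | measurable A \/ I A].

Definition BI_measurable : set (R -> R) :=
  [set f | measurable_fun setT (f : g_sigma_algebraType BI_generator -> R)].

End IdealInvariants.

Section DifferenceEquations.
Variable R : realType.

Definition difference_operator : set ((R -> R) -> (R -> R)) :=
  [set D | exists (n : nat) (a b : 'I_n -> R),
    D = fun f x => \sum_(i < n) a i * f (x + b i)].

Definition difference_system (S : set (((R -> R) -> (R -> R)) * (R -> R))) :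
  Prop := S `<=` difference_operator `*` setT.

Definition solution (S : set (((R -> R) -> (R -> R)) * (R -> R)))
  (f : R -> R) : Prop := forall D g, S (D, g) -> D f = g.

Definition solvability_cardinal (F : set (R -> R)) : cardinal :=
  min_card (fun K => forall S, difference_system S ->
    (forall S', S' `<=` S -> S' #< [set: K] ->
       exists2 f, F f & solution S' f) ->
    exists2 f, F f & solution S f).

End DifferenceEquations.

(* Main.v *)
Require Import Defs.
From mathcomp Require Import all_boot all_order all_algebra.
From mathcomp Require Import all_classical all_reals all_analysis.
From mathcomp Require Import measurable_realfun lra.
From mathcomp Require wochoice.

(** Let [N] be the least cardinality of a set outside [I], let [e : N -> R] be
    injective with range outside [I], and well-order [N] in its initial order
    type. For [t] in [N] let [G t] be the subgroup of the reals generated by the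
    rationals and the [e s] with [s <= t]. Since an infinite cardinal equals its
    square (card_square), [G t] has fewer than [N] elements, hence lies in [I];
    the [G t] increase, and their union is outside [I].

    Let [h] vanish off the union and be such that on it [h x] is [e t] for some
    [t] with [x] in [G t], where [t] depends only on the set of all such levels.
    Translating a point outside [G t] by an element of [G t] does not change its
    levels (levels_shift). Consider the system of all equations
    [f (x + b) - f x = h (x + b) - h x] with [b] in the union of the groups.

    Fewer than [cf N] of these equations only use translations from one [G t], and
    then [h] cut off outside [G t] solves them; it is measurable because it vanishes
    off a set of [I] (level_solution, level_subsystem_solvable). The full system
    has no measurable solution [f] (level_system_unsolvable). Indeed [f - h] is
    constant on the union of the groups, and [f] is rationally periodic off a set
    of [I], so by ergodicity [f], and with it [h] on the union, is constant off a
    set of [I] (invariant_constant). But [h] can take a given value only within one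
    [G t], and the union would be in [I]. Hence the solvability cardinal exceeds
    [cf N].

    Ergodicity of rational translations is proved separately for the two ideals.
    For null sets it follows from the density theorem: rational translations carry
    the balls about a density point of an invariant set into balls of twice the
    radius about a density point of its complement (null_ideal_ergodic). For meager sets
    an invariant set with the Baire property is almost equal to an open set, and
    rational translates of a nonempty open set cover the line
    (meager_ideal_ergodic).

    The remaining inequalities hold because the range of [e] is the union, over a
    cofinal set of indices, of initial segments belonging to [I], and because
    countable unions stay in [I]. *)

Set Implicit Arguments.
Unset Strict Implicit.
Unset Printing Implicit Defensive.
Import Order.TTheory GRing.Theory Num.Theory.
Import numFieldNormedType.Exports.
Local Open Scope classical_set_scope.
Local Open Scope card_scope.
Local Open Scope ring_scope.

(** * Comparison of cardinals *)

Lemma card_leT_inj (K L : Type) (f : K -> L) :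
  injective f -> [set: K] #<= [set: L].
Proof. by move=> f_inj; apply: (@card_le_fun _ _ _ _ f) => // x y _ _ /f_inj. Qed.

Lemma card_le_or T U (A : set T) (B : set U) : A #<= B \/ B #<= A.
Proof.
by rewrite -(card_le_eql (card_setT A)) -(card_le_eqr (card_setT B))
  -(card_le_eqr (card_setT A)) -(card_le_eql (card_setT B)); exact: card_le_total.
Qed.

Lemma card_ltNge T U (A : set T) (B : set U) : A #< B <-> ~ (B #<= A).
Proof. by split=> [[]//|nBA]; split=> //; case: (card_le_or A B). Qed.

Lemma card_le_lt_trans T U V (A : set T) (B : set U) (C : set V) :
  A #<= B -> B #< C -> A #< C.
Proof.
move=> AB [BC nCB]; split; first exact: card_le_trans AB BC.
by move=> CA; apply: nCB; exact: card_le_trans CA AB.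
Qed.

Lemma card_lt_le_trans T U V (A : set T) (B : set U) (C : set V) :
  A #< B -> B #<= C -> A #< C.
Proof.
move=> [AB nBA] BC; split; first exact: card_le_trans AB BC.
by move=> CA; apply: nBA; exact: card_le_trans BC CA.
Qed.

(** * Well-orders of initial order type *)

Section WellOrder.
Variables (K : Type) (W : rel K).
Hypothesis Wwo : wochoice.well_order W.

Lemma wo_min (A : set K) : A !=set0 -> exists2 z, A z & forall y, A y -> W z y.
Proof.
move=> [x Ax]; have [|z [[Az zmin] _]] := Wwo (A := fun u => `[< A u >]).
  by exists x; apply/asboolP.
exists z; first by move/asboolP: Az.
by move=> y Ay; apply: zmin; apply/asboolP.
Qed.

Lemma wo_refl x : W x x.
Proof. by have [|z -> zmin] := @wo_min [set x]; [exists x|exact: zmin]. Qed.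

Lemma wo_total x y : W x y \/ W y x.
Proof.
have [|z [->|->] zmin] := @wo_min [set x; y]; first by exists x; left.
- by left; apply: zmin; right.
- by right; apply: zmin; left.
Qed.

Lemma wo_anti x y : W x y -> W y x -> x = y.
Proof.
move=> xy yx; have [|z [_ zu]] := Wwo (A := fun u => `[< u = x \/ u = y >]).
  by exists x; apply/asboolP; left.
rewrite -(zu x) ?(zu y)//; split.
- by apply/asboolP; right.
- by move=> u /asboolP[->|->]//; exact: wo_refl.
- by apply/asboolP; left.
- by move=> u /asboolP[->|->]//; exact: wo_refl.
Qed.

Lemma wo_trans x y z : W x y -> W y z -> W x z.
Proof.
move=> xy yz; have [|m mP mmin] := @wo_min [set u | u = x \/ u = y \/ u = z].
  by exists x; left.
have mx : W m x by apply: mmin; left.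
have my : W m y by apply: mmin; right; left.
have mz : W m z by apply: mmin; right; right.
case: mP => [<-//|[e|e]].
  by rewrite (wo_anti xy)// -e.
by move: my; rewrite e => zy; rewrite (wo_anti zy yz) in xy *.
Qed.

Lemma wo_lt_nge x y : ~ W y x -> W x y /\ x <> y.
Proof.
move=> nyx; split; first by case: (wo_total x y).
by move=> e; apply: nyx; rewrite e; exact: wo_refl.
Qed.

End WellOrder.

Lemma wo_preimage (K L : Type) (W : rel L) (f : K -> L) : injective f ->
  wochoice.well_order W -> wochoice.well_order (fun a b => W (f a) (f b)).
Proof.
move=> f_inj Wwo A [a Aa].
have [|_ [b Ab <-] bmin] := @wo_min _ _ Wwo (f @` [set x | x \in A]).
  by exists (f a), a.
exists b; split=> [|c [Ac cmin]].
  by split=> // y Ay; apply: bmin; exists y.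
by apply: f_inj; apply: (wo_anti Wwo); [apply: bmin; exists c|exact: cmin].
Qed.

Lemma well_order_exists (K : Type) : exists W : rel K, wochoice.well_order W.
Proof. by have [W Wwo] := wochoice.well_ordering_principle {classic K}; exists W. Qed.

(** If some proper initial segment has full cardinality, the least such one has
    only smaller segments below it, and the order is transported from it. *)
Lemma initial_well_order_exists (K : Type) :
  exists W : rel K, initial_well_order W.
Proof.
have [W Wwo] := well_order_exists K.
have [allseg|/existsNP[x0 x0P]] := pselect
    (forall x, [set y | W y x /\ y <> x] #< [set: K]); first by exists W.
have [|x xP xmin] := @wo_min _ _ Wwo
    [set x | ~ ([set y | W y x /\ y <> x] #< [set: K])]; first by exists x0.
have /contrapT : ~ ~ ([set: K] #<= [set y | W y x /\ y <> x]).
  by move=> nle; apply: xP; apply/card_ltNge.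
rewrite -(card_le_eqr (card_setT _)) => /card_leT_fun[f f_inj].
pose g (a : K) : K := val (f a).
have g_inj : injective g by move=> a b /val_inj /f_inj.
exists (fun a b => W (g a) (g b)); split; first exact: wo_preimage.
move=> a; apply: (@card_le_lt_trans _ _ _ _ [set y | W y (g a) /\ y <> g a]).
  apply: (@card_le_fun _ _ _ _ g); last by move=> ? ? _ _ /g_inj.
  by move=> b [ba bna]; split=> // /g_inj.
have [xa xna] : W (g a) x /\ g a <> x by have := set_valP (f a).
apply: contrapT => /xmin ax; apply: xna; exact: (wo_anti Wwo).
Qed.

(** Transfinite recursion choosing at each stage a value not yet taken: the
    values already taken never exhaust [K]. *)
Lemma card_le_of_segments (T K : Type) (lt : T -> T -> Prop) :
  well_founded lt -> (forall x y, x <> y -> lt x y \/ lt y x) ->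
  (forall x, [set y | lt y x] #< [set: K]) -> [set: T] #<= [set: K].
Proof.
move=> lt_wf lt_tot seg.
have [[x0 _]|T0] := pselect ([set: T] !=set0); last first.
  by rewrite (_ : [set: T] = set0) ?card_ge0//; apply/seteqP; split=> // x _;
    apply: T0; exists x.
have [k0 _] : [set: K] !=set0.
  apply: contrapT => /nonemptyPn K0.
  by case: (seg x0) => _; rewrite K0; apply; exact: card_ge0.
have /choice[pick pickP] (A : set K) : exists k, A <> setT -> ~ A k.
  have [->|/eqP] := eqVneq A setT; first by exists k0.
  by move=> nA; have /existsNP[k kP] : ~ forall k, A k;
    [move=> AT; apply: nA; apply/seteqP; split|exists k].
(* [f x] is chosen outside the values of [f] below [x]. *)
pose F x (rec : forall y, lt y x -> K) :=
  pick [set k | exists y (h : lt y x), rec y h = k].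
pose f := Fix lt_wf (fun=> K) F.
have fE x : f x = pick (f @` [set y | lt y x]).
  rewrite /f Fix_eq -/f; last first.
    move=> y g h gh; rewrite /F; congr pick; apply/seteqP; split=> k /=;
      by move=> [z [hz <-]]; exists z, hz; rewrite gh.
  rewrite /F; congr pick; apply/seteqP; split=> k /=.
    by move=> [y [yx <-]]; exists y.
  by move=> [y yx <-]; exists y, yx.
have fN x y : lt y x -> f y <> f x.
  move=> yx fyx; apply: (pickP (f @` [set y | lt y x])).
    by move=> e; case: (seg x) => _; apply; rewrite -e; exact: card_image_le.
  by rewrite -fE -fyx; exists y.
apply: (@card_leT_inj _ _ f) => x y fxy; apply: contrapT => /lt_tot[/fN|/fN].
  exact.
by apply.
Qed.

(** * Squares and lists over an infinite cardinal *)

(** An infinite type contains a copy of [nat]; shifting it makes room for one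
    more point. *)
Lemma card_le_succ (K : Type) : infinite_set [set: K] ->
  [set: option K] #<= [set: K].
Proof.
move=> /infiniteP /card_leT_fun[f f_inj].
pose g (o : option K) := if o is Some k then
  if pselect (exists n, f n = k) is left h then f (projT1 (cid h)).+1 else k
  else f 0%N.
apply: (@card_leT_inj _ _ g) => -[a|] [b|] //=.
- case: pselect => [ha|nha]; case: pselect => [hb|nhb].
  + case: cid => n /= <-; case: cid => m /= <-.
    by move=> /f_inj [->].
  + by move=> fb; case: nhb; eexists; exact: fb.
  + by move=> fa; case: nha; eexists; exact: esym fa.
  + by move=> ->.
- case: pselect => [ha|nha]; first by move=> /f_inj.
  by move=> fa; case: nha; eexists; exact: esym fa.
- case: pselect => [ha|nha]; first by move=> /f_inj.
  by move=> fa; case: nha; eexists; exact: fa.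
Qed.

(** Only a greatest element could make a closed initial segment large, and
    removing it does not change an infinite cardinal. *)
Lemma closed_segment_lt (K : Type) (W : rel K) : infinite_set [set: K] ->
  initial_well_order W -> forall x, [set y | W y x] #< [set: K].
Proof.
move=> Kinf [Wwo seg] x; apply/card_ltNge => Kle; case: (seg x) => _; apply.
have [xmax|/existsNP[z zx]] := pselect (forall z, W z x); last first.
  exfalso; have [xz xnz] := wo_lt_nge Wwo zx.
  case: (seg z) => _; apply; apply: card_le_trans Kle _; apply: subset_card_le.
  move=> y /= yx; split; first exact: (wo_trans Wwo yx).
  by move=> yz; apply: zx; rewrite -yz.
have /card_leT_fun[f f_inj] := card_le_succ Kinf.
have [g g_inj gP] : exists2 g : K -> K, injective g & forall k, g k <> x.
  have [[a fa]|nfx] := pselect (exists a, f (Some a) = x); last first.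
    by exists (f \o Some) => [a b /= /f_inj[]|k fk]//; apply: nfx; exists k.
  exists (fun k => if pselect (k = a) is left _ then f None else f (Some k)).
    move=> b c; case: pselect => [->|nb]; case: pselect => [->|nc] // /f_inj//.
    by case.
  by move=> k; case: pselect => [_|nk]; rewrite -fa => /f_inj// -[].
by apply: (@card_le_fun _ _ _ _ g) => [k _|a b _ _ /g_inj//]; split.
Qed.

Lemma card_leT_prod (K K' L L' : Type) : [set: K] #<= [set: K'] ->
  [set: L] #<= [set: L'] -> [set: (K * L)%type] #<= [set: (K' * L')%type].
Proof.
move=> /card_leT_fun[f f_inj] /card_leT_fun[g g_inj].
apply: (@card_leT_inj _ _ (fun p => (f p.1, g p.2))) => -[a b] [c d] /= [].
by move=> /f_inj -> /g_inj ->.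
Qed.

(** Goedel's ordering of the square: pairs are compared by their maximum first,
    so that every initial segment lies in the square of a closed segment. *)
Lemma card_square_step (K : Type) : infinite_set [set: K] ->
  (forall A : set K, infinite_set [set: A] -> [set: A] #< [set: K] ->
     [set: (A * A)%type] #<= [set: A]) ->
  [set: (K * K)%type] #<= [set: K].
Proof.
move=> Kinf sq; have [W Wini] := initial_well_order_exists K.
have [V Vwo] := well_order_exists (K * K)%type.
have Wwo := Wini.1.
pose mx (p : K * K) := if W p.1 p.2 then p.2 else p.1.
have mx1 p : W p.1 (mx p).
  by rewrite /mx; case: ifP => // _; exact: (wo_refl Wwo).
have mx2 p : W p.2 (mx p).
  rewrite /mx; case: ifPn => [_|/negP]; first exact: (wo_refl Wwo).
  by move=> /(wo_lt_nge Wwo)[].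
pose lt (p q : K * K) :=
  (W (mx p) (mx q) /\ mx p <> mx q) \/ (mx p = mx q /\ V p q /\ p <> q).
apply: (@card_le_of_segments _ _ lt).
- move=> p; apply: contrapT => nAcc.
  have [|_ [q qP <-] qmin] := @wo_min _ _ Wwo (mx @` [set q | ~ Acc lt q]).
    by exists (mx p), p.
  have [|r [rP rq] rmin] :=
      @wo_min _ _ Vwo [set r | ~ Acc lt r /\ mx r = mx q].
    by exists q.
  apply: rP; split=> s [[sr snr]|[sr [Vsr snr]]]; apply: contrapT => sP.
    apply: snr; apply: (wo_anti Wwo) => //.
    by rewrite rq; apply: qmin; exists s.
  by apply: snr; apply: (wo_anti Vwo) => //; apply: rmin; split=> //; rewrite sr.
- move=> p q npq; have [mpq|mpq] := pselect (mx p = mx q).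
    have [Vpq|Vqp] := wo_total Vwo p q; first by left; right.
    by right; right; split=> //; split=> // /esym.
  have [Wpq|Wqp] := wo_total Wwo (mx p) (mx q); first by left; left.
  by right; left; split=> // /esym.
- move=> p; pose A := [set y | W y (mx p)].
  have AK : [set: A] #< [set: K].
    apply: card_le_lt_trans (closed_segment_lt Kinf Wini (mx p)).
    by rewrite (card_le_eql (card_setT _)) card_lexx.
  apply: (@card_le_lt_trans _ _ _ _ [set: (A * A)%type]); last first.
    have [Afin|Ainf] := pselect (finite_set [set: A]); last first.
      exact: card_le_lt_trans (sq A Ainf AK) AK.
    apply/card_ltNge => /card_le_finite; apply: contra_not Kinf; apply.
    by rewrite -setXTT; exact: finite_setX.
  rewrite -(card_le_eql (card_setT _)).
  have qA (q : [set q | lt q p]) : A (val q).1 /\ A (val q).2.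
    have Wq : W (mx (val q)) (mx p).
      by have [[]//|[-> _]] := set_valP q; exact: (wo_refl Wwo).
    by split; apply: (wo_trans Wwo) Wq; [exact: mx1|exact: mx2].
  pose g (q : [set q | lt q p]) : A * A :=
    (SigSub (mem_set (qA q).1), SigSub (mem_set (qA q).2)).
  apply: (@card_leT_inj _ _ g) => q r [e1 e2]; apply: val_inj.
  by rewrite (surjective_pairing (val q)) (surjective_pairing (val r)); congr pair.
Qed.

(** A least cardinal violating the statement would have all its smaller infinite
    subsets equinumerous to their squares, which is what the previous lemma
    excludes. *)
Theorem card_square (K : Type) : infinite_set [set: K] ->
  [set: (K * K)%type] #<= [set: K].
Proof.
move=> Kinf; apply: contrapT => nsq.
have transfer (A B : Type) : [set: A] #<= [set: B] -> [set: B] #<= [set: A] ->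
    [set: (A * A)%type] #<= [set: A] -> [set: (B * B)%type] #<= [set: B].
  move=> AB BA sqA; apply: card_le_trans (card_leT_prod BA BA) _.
  exact: card_le_trans sqA AB.
have [|A [Ainf nsqA] Amin] := @card_least K
    [set A : set K | infinite_set [set: A] /\ ~ ([set: (A * A)%type] #<= [set: A])].
  have [le1 le2] : [set: [set: K]] #<= [set: K] /\ [set: K] #<= [set: [set: K]].
    by split; rewrite ?(card_le_eql (card_setT _)) ?(card_le_eqr (card_setT _))
      card_lexx.
  exists setT; split; last by move=> sqT; apply: nsq; apply: transfer sqT.
  by move=> Tfin; apply: Kinf; exact: card_le_finite le2 Tfin.
apply: nsqA; apply: card_square_step => // B Binf [BA nAB].
pose B' : set K := val @` B.
have eB : B' #= B by apply: inj_card_eq => x y _ _ /val_inj.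
have [le1 le2] : [set: B] #<= [set: B'] /\ [set: B'] #<= [set: B].
  rewrite !(card_le_eql (card_setT _)) !(card_le_eqr (card_setT _)).
  by rewrite (card_le_eql eB) (card_le_eqr eB) card_lexx.
apply: (@transfer B' B) => //; apply: contrapT => nsqB.
apply: nAB; apply: card_le_trans le2.
have : A #<= B'.
  by apply: Amin; split=> // Bfin; apply: Binf; exact: card_le_finite le1 Bfin.
by rewrite -(card_le_eql (card_setT A)) -(card_le_eqr (card_setT B')).
Qed.

(** Iterating an injective pairing encodes lists injectively only among lists of
    one length, so the length is recorded as well. *)
Lemma card_seq (K : Type) : infinite_set [set: K] ->
  [set: seq K] #<= [set: K].
Proof.
move=> Kinf; have /card_leT_fun[pr pr_inj] := card_square Kinf.
have /infiniteP /card_leT_fun[i i_inj] := Kinf.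
pose enc := fix enc (s : seq K) :=
  if s is x :: s' then pr (x, enc s') else i 0%N.
apply: (@card_leT_inj _ _ (fun s => pr (i (size s), enc s))) => s t /pr_inj[].
move=> /i_inj; elim: s t => [|x s IHs] [|y t] //= [st] /pr_inj[-> e].
by rewrite (IHs t).
Qed.

(** * Successors and cofinalities *)

Lemma succ_cardP (K : cardinal) :
  is_min_card (fun L => [set: K] #< [set: L]) (succ_card K).
Proof.
apply: min_cardP => [L L' LL' KL|].
  by apply: card_lt_le_trans KL _; rewrite (card_le_eql LL') card_lexx.
(* Cantor's theorem: the power set is larger than [K]. *)
exists (set K); split.
  by apply: (@card_leT_inj _ _ set1) => x y /seteqP[/(_ x erefl)].
move=> /card_leT_fun[f f_inj].
pose D := [set k | exists2 A, f A = k & ~ A k].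
have nD : ~ D (f D) by move=> [A /f_inj -> nDD]; apply: (nDD); exists D.
by apply: (nD); exists D.
Qed.

Lemma succ_card_le (K L : cardinal) :
  [set: K] #< [set: L] -> [set: succ_card K] #<= [set: L].
Proof. exact: (succ_cardP K).2. Qed.

Lemma succ_card_mono (K L : cardinal) :
  [set: K] #<= [set: L] -> [set: succ_card K] #<= [set: succ_card L].
Proof.
move=> KL; apply: succ_card_le; exact: card_le_lt_trans KL (succ_cardP L).1.
Qed.

Lemma cofinalityP (K : cardinal) : is_min_card (fun L =>
  exists (W : rel K) (A : set K),
    [/\ initial_well_order W, cofinal W A & A #= [set: L]]) (cofinality K).
Proof.
apply: min_cardP => [L L' LL' [W [A [? ? AL]]]|].
  by exists W, A; split=> //; exact: card_eq_trans AL LL'.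
have [W Wini] := initial_well_order_exists K.
exists K, W, setT; split=> [//|x|]; last exact: card_eqxx.
by exists x => //; exact: (wo_refl Wini.1).
Qed.

(** * Sets of less than a given uncountable cardinality *)

Section UncountableBounds.
Variables (N T U : Type).
Hypothesis N_unc : [set: nat] #< [set: N].

(** Cardinal arithmetic below [N] reduces to a single infinite cardinal, where
    squares and lists add nothing. *)
Lemma infinite_common_bound (A : set T) (B : set U) :
  A #< [set: N] -> B #< [set: N] -> exists M : Type,
  [/\ infinite_set [set: M], A #<= [set: M], B #<= [set: M]
    & [set: M] #< [set: N]].
Proof.
move=> AN BN.
have two (K L : Type) : [set: K] #< [set: N] -> [set: L] #< [set: N] ->
    exists M : Type, [/\ [set: K] #<= [set: M], [set: L] #<= [set: M]
      & [set: M] #< [set: N]].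
  by move=> KN LN; have [KL|LK] := card_le_total K L;
    [exists L|exists K]; split=> //; exact: card_lexx.
have [||M [AM BM MN]] := two A B.
- by apply: card_le_lt_trans AN; rewrite (card_le_eql (card_setT _)) card_lexx.
- by apply: card_le_lt_trans BN; rewrite (card_le_eql (card_setT _)) card_lexx.
have [M' [MM' natM' M'N]] := two M nat MN N_unc.
exists M'; split=> //; first exact/infiniteP.
- by rewrite -(card_le_eql (card_setT A)); exact: card_le_trans AM MM'.
- by rewrite -(card_le_eql (card_setT B)); exact: card_le_trans BM MM'.
Qed.

End UncountableBounds.

Lemma card_lt_setU (N T : Type) (A B : set T) : [set: nat] #< [set: N] ->
  A #< [set: N] -> B #< [set: N] -> A `|` B #< [set: N].
Proof.
move=> N_unc AN BN.
have [M [Minf AM BM MN]] := infinite_common_bound N_unc AN BN.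
apply: card_le_lt_trans MN; apply: card_le_trans (card_square Minf).
have /infiniteP /card_leT_fun[i i_inj] := Minf.
move: AM BM; rewrite -(card_le_eql (card_setT A)) -(card_le_eql (card_setT B)).
move=> /card_leT_fun[f f_inj] /card_leT_fun[g g_inj].
rewrite -(card_le_eql (card_setT _)).
have inB (x : set_type (A `|` B)) : ~ A (val x) -> B (val x).
  by move=> nA; case: (set_valP x).
pose k (x : set_type (A `|` B)) : M * M :=
  match pselect (A (val x)) with
  | left Ax => (f (SigSub (mem_set Ax)), i 0%N)
  | right nAx => (g (SigSub (mem_set (inB x nAx))), i 1%N)
  end.
apply: (@card_leT_inj _ _ k) => x y; rewrite /k.
case: pselect => Ax; case: pselect => Ay [].
- by move=> /f_inj /(congr1 val) /= xy; exact: val_inj.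
- by move=> _ /i_inj.
- by move=> _ /i_inj.
- by move=> /g_inj /(congr1 val) /= xy; exact: val_inj.
Qed.

(** * Generated subgroups *)

Section GeneratedSubgroup.
Variable V : zmodType.
Implicit Types A B : set V.

(** The subgroup generated by [A], given by words so that its elements can be
    counted. *)
Definition gen_subgroup A : set V :=
  range (fun w : seq A * seq A =>
    \sum_(a <- w.1) (val a : V) - \sum_(a <- w.2) (val a : V)).

Lemma gen_subgroup0 A : gen_subgroup A 0.
Proof. by exists ([::], [::]) => //=; rewrite !big_nil subr0. Qed.

Lemma gen_subgroupB A x y :
  gen_subgroup A x -> gen_subgroup A y -> gen_subgroup A (x - y).
Proof.
move=> [[s t] _ <-] [[s' t'] _ <-]; exists (s ++ t', t ++ s') => //=.
by rewrite !big_cat /= opprD addrACA opprB.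
Qed.

Lemma gen_subgroupDr A x b : gen_subgroup A b ->
  gen_subgroup A (x + b) <-> gen_subgroup A x.
Proof.
move=> Ab; split=> [Axb|Ax]; first by rewrite -(addrK b x); exact: gen_subgroupB.
rewrite -[b]opprK; apply: gen_subgroupB => //; rewrite -sub0r.
by apply: gen_subgroupB => //; exact: gen_subgroup0.
Qed.

Lemma sub_gen_subgroup A : A `<=` gen_subgroup A.
Proof.
move=> x Ax; exists ([:: SigSub (mem_set Ax)], [::]) => //=.
by rewrite big_seq1 big_nil subr0.
Qed.

Lemma gen_subgroup_mono A B : A `<=` B -> gen_subgroup A `<=` gen_subgroup B.
Proof.
move=> AB _ [[s t] _ <-].
pose j (a : A) : B := SigSub (mem_set (AB _ (set_valP a))).
by exists (map j s, map j t) => //=; rewrite !big_map.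
Qed.

Lemma card_gen_subgroup_lt (N : Type) A : [set: nat] #< [set: N] ->
  A #< [set: N] -> gen_subgroup A #< [set: N].
Proof.
move=> N_unc AN; have [M [Minf AM _ MN]] := infinite_common_bound N_unc AN AN.
apply: card_le_lt_trans MN; apply: card_le_trans (card_image_le _ _) _.
apply: card_le_trans (card_square Minf).
have seqA : [set: seq A] #<= [set: M].
  apply: card_le_trans (card_seq Minf); move: AM.
  rewrite -(card_le_eql (card_setT A)) => /card_leT_fun[f f_inj].
  by apply: (@card_leT_inj _ _ (map f)); exact: inj_map.
exact: card_leT_prod.
Qed.

End GeneratedSubgroup.

(** * Ergodic ideals *)

Section SigmaIdeal.
Variable R : realType.
Implicit Types (I : set (set R)) (A B E : set R).

Record sigma_ideal I : Prop := SigmaIdeal {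
  ideal_sub : forall A B, A `<=` B -> I B -> I A;
  ideal_bigcup : forall F : nat -> set R,
    (forall n, I (F n)) -> I (\bigcup_n F n);
  ideal_set1 : forall x, I [set x];
  ideal_proper : ~ I setT }.

(** All that the construction needs to know about null and meager sets: they form
    a proper sigma-ideal for which rational translations act ergodically. *)
Record ergodic_ideal I : Prop := ErgodicIdeal {
  ergodic_sigma_ideal :> sigma_ideal I;
  ideal_ergodic : forall E, <<s BI_generator I >> E ->
    (forall (q : rat) x, E x -> E (x + ratr q)) -> I E \/ I (~` E) }.

Variable I : set (set R).
Hypothesis HI : sigma_ideal I.

Lemma ideal_setU A B : I A -> I B -> I (A `|` B).
Proof.
move=> IA IB; rewrite -bigcup2E; apply: (ideal_bigcup HI) => -[//|[//|n]] /=.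
by apply: (ideal_sub HI) IA; exact: sub0set.
Qed.

Lemma ideal_countable_bigcup (T : Type) (D : set T) (F : T -> set R) :
  countable D -> (forall t, D t -> I (F t)) -> I (\bigcup_(t in D) F t).
Proof.
move=> /countable_injP[i i_inj] IF.
apply: (@ideal_sub _ HI _ (\bigcup_n \bigcup_(t in [set t | D t /\ i t = n]) F t)).
  by move=> x [t Dt Fx]; exists (i t) => //; exists t.
apply: (ideal_bigcup HI) => n.
have [[t [Dt itn]]|nt] := pselect (exists t, D t /\ i t = n).
  apply: (ideal_sub HI) (IF t Dt) => x [u [Du iun] Fx].
  by rewrite (i_inj t u) ?inE// itn iun.
apply: (ideal_sub HI) (ideal_set1 HI 0) => x [t tP _].
by exfalso; apply: nt; exists t.
Qed.

Lemma ideal_countable A : countable A -> I A.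
Proof.
move=> cA; apply: (@ideal_sub _ HI _ (\bigcup_(x in A) [set x])).
  by move=> x Ax; exists x.
by apply: ideal_countable_bigcup => // x _; exact: ideal_set1.
Qed.

Lemma ideal_measurable A : I A -> <<s BI_generator I >> A.
Proof. by move=> IA; apply: sub_sigma_algebra; right. Qed.

Lemma ideal_measurableC A : I A -> <<s BI_generator I >> (~` A).
Proof.
move=> IA; rewrite -setTD; have [_ sC _] := smallest_sigma_algebra setT (BI_generator I).
by apply: sC; exact: ideal_measurable.
Qed.

(** The sets that agree with a member of [P] up to [I] form a sigma-algebra
    containing the open sets and [I]. This is used with the Borel sets for the
    null ideal and with the open sets for the meager ideal. *)
Lemma BI_generated_approx (P : set (set R)) :
  (forall U, open U -> P U) ->
  (forall F : nat -> set R, (forall n, P (F n)) -> P (\bigcup_n F n)) ->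
  (forall B, P B -> exists2 B', P B' & I (~` B `+` B')) ->
  forall E, <<s BI_generator I >> E -> exists2 B, P B & I (E `+` B).
Proof.
move=> Popen Pbigcup PC.
pose C := [set E | exists2 B, P B & I (E `+` B)].
have I0 : I set0 by apply: (ideal_sub HI) (ideal_set1 HI 0); exact: sub0set.
have symC (A B : set R) : ~` A `+` ~` B = A `+` B.
  by rewrite /setY !setDE !setCK setUC setIC [~` A `&` _]setIC.
have symT (A B D : set R) : A `+` D `<=` (A `+` B) `|` (B `+` D).
  by move=> x [[]|[]] /=; have [?|?] := pselect (B x); tauto.
have openC U : open U -> C U by move=> oU; exists U; [exact: Popen|rewrite setYK].
have Csigma : sigma_algebra setT C.
  split; first exact: openC open0.
    move=> A [B PB IAB]; have [B' PB' IB'] := PC _ PB; exists B' => //.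
    apply: (ideal_sub HI) (symT _ (~` B) _) _; apply: ideal_setU => //.
    by rewrite setTD symC.
  move=> A CA; have /choice[B AB] n : exists D, P D /\ I (A n `+` D).
    by have [D] := CA n; exists D.
  exists (\bigcup_n B n); first by apply: Pbigcup => n; exact: (AB n).1.
  apply: (ideal_sub HI) (ideal_bigcup HI (fun n => (AB n).2)) => x.
  move=> [[[n _ Ax] nB]|[[n _ Bx] nA]]; exists n => //.
    by left; split=> // Bx; apply: nB; exists n.
  by right; split=> // Ax; apply: nA; exists n.
apply: smallest_sub => // A [mA|IA]; last first.
  by exists set0; [exact/Popen/open0|rewrite setY0].
move: A mA; rewrite [measurable](RGenOpens.measurableE R).
by apply: smallest_sub => // _ [x [y ->]]; exact/openC/interval_open.
Qed.

End SigmaIdeal.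

Section ErgodicIdeal.
Variables (R : realType) (I : set (set R)).
Hypothesis HI : ergodic_ideal I.

(** By ergodicity each sublevel set of [f] at a rational height belongs to [I] or
    has its complement in [I]. *)
Lemma invariant_constant (f : R -> R) (A : set R) : BI_measurable I f -> I A ->
  (forall (q : rat) x, A x -> A (x + ratr q)) ->
  (forall (q : rat) x, ~ A x -> f (x + ratr q) = f x) ->
  exists2 B, I B & forall x y, ~ B x -> ~ B y -> f x = f y.
Proof.
move=> mf IA Ainv finv.
pose E (r : rat) := [set x | f x < ratr r] `\` A.
have dich r : I [set x | f x < ratr r] \/ I [set x | ratr r <= f x].
  have [||IE|IEc] := @ideal_ergodic _ _ HI (E r).
  - have mB : measurable (`]-oo, (ratr r : R)[%classic : set R) by [].
    have /= := mf measurableT _ mB; rewrite setTI => mfr.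
    have := @measurableD _ (g_sigma_algebraType (BI_generator I)) _ _ mfr
      (ideal_measurable IA).
    by rewrite /E; congr (<<s _ >> (_ `\` _)); apply/seteqP; split=> x /=;
      rewrite in_itv.
  - move=> q x [fx nAx]; split=> /=; first by rewrite finv.
    move=> Aq; apply: nAx; rewrite -(addrK (ratr q) x) -(rmorphN (@ratr R)).
    exact: Ainv.
  - left; apply: (@ideal_sub _ _ HI _ (E r `|` A)); last exact: (ideal_setU HI).
    by move=> x fx; have [Ax|nAx] := pselect (A x); [right|left].
  - right; apply: (ideal_sub HI) IEc => x /= rf [fx _].
    by move: fx; rewrite /= ltNge rf.
(* Each rational level discards whichever of its two sides is in [I]; two points
   that survive cannot be separated by a rational. *)
pose B (r : rat) := [set x | (I [set x | f x < ratr r] /\ f x < ratr r) \/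
  (I [set x | ratr r <= f x] /\ ratr r <= f x)].
exists (\bigcup_(r in [set: rat]) B r).
  apply: (ideal_countable_bigcup HI) => [|r _]; first exact: countableP.
  apply: (@ideal_sub _ _ HI _ ([set x | I [set x | f x < ratr r] /\ f x < ratr r]
    `|` [set x | I [set x | ratr r <= f x] /\ ratr r <= f x])) => //.
  have I0 : I set0 by apply: (ideal_sub HI) IA; exact: sub0set.
  apply: (ideal_setU HI).
  - have [Ir|nIr] := pselect (I [set x | f x < ratr r]).
      by apply: (ideal_sub HI) Ir => x [].
    by apply: (ideal_sub HI) I0 => x [].
  - have [Ir|nIr] := pselect (I [set x | ratr r <= f x]).
      by apply: (ideal_sub HI) Ir => x [].
    by apply: (ideal_sub HI) I0 => x [].
have le x y : ~ (\bigcup_(r in [set: rat]) B r) x ->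
    ~ (\bigcup_(r in [set: rat]) B r) y -> f x <= f y.
  move=> nBx nBy; rewrite leNgt; apply/negP => fyx.
  have [r] := rat_in_itvoo fyx; rewrite in_itv /= => /andP[fyr frx].
  have [Ilt|Ige] := dich r.
    by apply: nBy; exists r => //; left.
  by apply: nBx; exists r => //; right; split=> //; exact: ltW.
by move=> x y nBx nBy; apply/eqP; rewrite eq_le !le.
Qed.

End ErgodicIdeal.

(** * A system with small solvable subsystems *)

Section UnsolvableSystem.
Variables (R : realType) (I : set (set R)).
Hypothesis HI : ergodic_ideal I.
Variables (N : Type) (e : N -> R) (W : rel N).
Hypothesis N_unc : [set: nat] #< [set: N].
Hypothesis e_inj : injective e.
Hypothesis range_e : ~ I (range e).
Hypothesis I_small : forall A : set R, A #< [set: N] -> I A.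
Hypothesis W_ini : initial_well_order W.

(** The rationals are included so that being a solution forces rational
    periodicity, to which ergodicity applies. *)
Definition level_group (t : N) : set R :=
  gen_subgroup (range (@ratr R) `|` e @` [set s | W s t]).

Local Notation G := level_group.

Lemma level_group_mono s t : W s t -> G s `<=` G t.
Proof.
move=> st; apply: gen_subgroup_mono => x [Qx|[u us <-]]; first by left.
by right; exists u => //; exact: (wo_trans W_ini.1) us st.
Qed.

Lemma level_group_rat t q : G t (ratr q).
Proof. by apply: sub_gen_subgroup; left; exists q. Qed.

Lemma level_group_e t : G t (e t).
Proof. by apply: sub_gen_subgroup; right; exists t => //; exact: (wo_refl W_ini.1). Qed.

Lemma uncountable_infinite : infinite_set [set: N].
Proof. by apply/infiniteP; case: N_unc. Qed.

(** The group has fewer elements than [N], which is uncountable, so it is covered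
    by [I_small]. *)
Lemma level_group_ideal t : I (G t).
Proof.
apply/I_small/card_gen_subgroup_lt => //; apply: card_lt_setU => //.
  apply: card_le_lt_trans N_unc; apply: card_le_trans (card_image_le _ _) _.
  by rewrite (card_le_eql card_rat) card_lexx.
apply: card_le_lt_trans (card_image_le _ _) _.
exact: closed_segment_lt uncountable_infinite W_ini t.
Qed.

Definition levels (x : R) : set N := [set t | G t x].

(** The groups form a chain: those below [t] contain neither [x] nor [x + b], and
    those above [t] contain [b], hence both points or neither. *)
Lemma levels_shift t x b : G t b -> ~ G t x -> levels (x + b) = levels x.
Proof.
move=> tb ntx; apply/seteqP; split=> u /= ux.
  have [ut|tu] := wo_total W_ini.1 u t.
    by exfalso; apply: ntx; apply/(gen_subgroupDr x tb); exact: level_group_mono ux.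
  exact/(gen_subgroupDr x (level_group_mono tu tb)).
have [ut|tu] := wo_total W_ini.1 u t.
  by exfalso; apply: ntx; exact: level_group_mono ux.
exact/(gen_subgroupDr x (level_group_mono tu tb)).
Qed.

(** The value of [h] at [x] depends only on the set of levels of [x], which gives
    [h] its periods, and yet it names one of them, which makes every fibre of
    [h] on the union of the groups small. *)
Lemma level_function_exists : exists h : R -> R,
  (forall x y, levels x = levels y -> h x = h y) /\
  (forall x, levels x !=set0 -> exists2 t, levels x t & h x = e t).
Proof.
have [n0 _] := infinite_setN0 uncountable_infinite.
have /choice[pick pickP] (A : set N) : exists t, A !=set0 -> A t.
  by have [[t At]|nA] := pselect (A !=set0); [exists t|exists n0].
exists (fun x => e (pick (levels x))); split=> [x y ->//|x xl].
by exists (pick (levels x)) => //; exact: pickP.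
Qed.

Definition level_union : set R := \bigcup_t G t.

Definition shift_difference (b : R) (f : R -> R) (x : R) : R := f (x + b) - f x.

Lemma shift_difference_operator b :
  difference_operator (shift_difference b).
Proof.
exists 2%N, (fun i => if i == ord0 then 1 else -1),
  (fun i => if i == ord0 then b else 0); apply/funext => f; apply/funext => x.
by rewrite big_ord_recl big_ord1 /= mul1r mulN1r addr0.
Qed.

Definition level_system (h : R -> R) :=
  [set p | exists2 b, level_union b &
     p = (shift_difference b, shift_difference b h)].

Section Solutions.
Variable h : R -> R.
Hypothesis h_levels : forall x y, levels x = levels y -> h x = h y.
Hypothesis h_e : forall x, levels x !=set0 -> exists2 t, levels x t & h x = e t.

(** The function [h] cut off outside [G t] vanishes off a set of the ideal, and
    differs from [h] by a function with all periods in [G t]. *)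
Lemma level_solution t : exists2 f, BI_measurable I f &
  forall b, G t b -> shift_difference b f = shift_difference b h.
Proof.
pose f x := if pselect (G t x) is left _ then h x else 0.
have fG x : G t x -> f x = h x by rewrite /f; case: pselect.
have fnG x : ~ G t x -> f x = 0 by rewrite /f; case: pselect.
exists f => [_ B _ /=|b tb].
  rewrite setTI; have [B0|nB0] := pselect (B 0).
    (* the preimage contains the complement of [G t] *)
    rewrite -(setCK (f @^-1` B)); apply: (@ideal_measurableC _ I).
    apply: (ideal_sub HI) (level_group_ideal t) => x nBx; apply: contrapT => /fnG fx.
    by apply: nBx; rewrite /= fx.
  apply: (@ideal_measurable _ I); apply: (ideal_sub HI) (level_group_ideal t) => x Bx.
  by apply: contrapT => /fnG fx; apply: nB0; rewrite -fx.
apply/funext => x; rewrite /shift_difference.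
have [tx|ntx] := pselect (G t x).
  by rewrite !fG//; apply/gen_subgroupDr.
rewrite !fnG//; last by move=> /(gen_subgroupDr x tb).
by rewrite (h_levels (levels_shift tb ntx)) !subrr.
Qed.

(** Fewer than cofinality many equations only use translations from a single
    [G t], because the levels they come from are not cofinal. *)
Lemma level_subsystem_solvable S' : S' `<=` level_system h ->
  S' #< [set: cofinality N] ->
  exists2 f, BI_measurable I f & solution S' f.
Proof.
move=> sub S'lt.
have [n0 _] := infinite_setN0 uncountable_infinite.
have /choice[k kP] p : exists t, S' p -> exists2 b, G t b &
    p = (shift_difference b, shift_difference b h).
  have [S'p|nS'p] := pselect (S' p); last by exists n0.
  by have [b [t _ tb] ->] := sub p S'p; exists t => _; exists b.
have [t tP] : exists t, forall p, S' p -> W (k p) t.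
  apply: contrapT => nt; have : cofinal W (k @` S').
    move=> x; apply: contrapT => nx; apply: nt; exists x => p S'p.
    have [//|xkp] := wo_total W_ini.1 (k p) x.
    by exfalso; apply: nx; exists (k p) => //; exists p.
  move=> kcof.
  case: S'lt => _; apply; apply: card_le_trans (card_image_le k S').
  rewrite -(card_le_eqr (card_setT (k @` S'))); apply: (cofinalityP N).2.
  exists W, (k @` S'); split=> //; exact: card_setT_sym.
have [f mf fP] := level_solution t; exists f => // D g S'Dg.
have [b kb [-> ->]] := kP _ S'Dg; apply: fP.
by apply: level_group_mono kb; exact: tP.
Qed.

(** A measurable solution [f] differs from [h] by a constant on the union of the
    groups, and it is rationally periodic off one of them, so [f] is constant
    off a set [B] of the ideal. Then [h] is constant on the part of the union
    outside [B]; a value of [h] names a level, so that part lies in one level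
    group, and the range of [e] would belong to [I]. *)
Lemma level_system_unsolvable :
  ~ exists2 f, BI_measurable I f & solution (level_system h) f.
Proof.
move=> [f mf fS]; have [n0 _] := infinite_setN0 uncountable_infinite.
have fh b x : level_union b -> f (x + b) - f x = h (x + b) - h x.
  move=> Gb; have /(congr1 (fun F => F x)) : shift_difference b f =
    shift_difference b h by apply: fS; exists b.
  exact.
have [||B IB fB] := invariant_constant HI mf (level_group_ideal n0).
- by move=> q x n0x; apply/(gen_subgroupDr x (level_group_rat n0 q)).
- move=> q x nGx; have nq := level_group_rat n0 q.
  have := fh (ratr q) x; rewrite (h_levels (levels_shift nq nGx)) subrr.
  by move=> /(_ _)/eqP; rewrite subr_eq0 => H; apply/eqP/H; exists n0.
apply: range_e.
have [[x [t _ tx] nBx]|nx] := pselect (exists2 x, level_union x & ~ B x);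
    last first.
  apply: (ideal_sub HI) IB => _ [t _ <-]; apply: contrapT => nB; apply: nx.
  by exists (e t) => //; exists t => //; exact: level_group_e.
have [|s sx hx] := h_e (x := x); first by exists t.
apply: (@ideal_sub _ _ HI _ (B `|` G s)).
  move=> _ [u _ <-]; have [Bu|nBu] := pselect (B (e u)); [by left|right].
  have fhG y : level_union y -> f y - h y = f 0 - h 0.
    move=> Gy; have := fh y 0 Gy; rewrite add0r => /eqP; rewrite subr_eq => /eqP ->.
    by rewrite -addrA addrC [h y - h 0]addrC addrA [f 0 - h y - _]addrAC subrK.
  have [|v vu hu] := h_e (x := e u); first by exists u; exact: level_group_e.
  have : h x = h (e u).
    have Gx : level_union x by exists t.
    have Gu : level_union (e u) by exists u => //; exact: level_group_e.
    have := fhG _ Gx; rewrite -(fhG _ Gu) (fB x (e u))//.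
    by move=> /addrI /oppr_inj.
  by rewrite hx hu => /e_inj ->.
by apply: (ideal_setU HI) => //; exact: level_group_ideal.
Qed.

End Solutions.
End UnsolvableSystem.

(** * Cardinal invariants of an ideal *)

Section IdealCardinals.
Variables (R : realType) (I : set (set R)).
Hypothesis HI : ergodic_ideal I.

Lemma non_idealP : is_min_card
  (fun K => exists A : set R, ~ I A /\ A #= [set: K]) (non_ideal I).
Proof.
apply: min_cardP => [K L KL [A [? AK]]|].
  by exists A; split=> //; exact: card_eq_trans AK KL.
by exists R, setT; split; [exact: ideal_proper HI|exact: card_eqxx].
Qed.

Lemma add_idealP : is_min_card (fun K => exists A : set (set R),
  [/\ A `<=` I, ~ I (\bigcup_(X in A) X) & A #= [set: K]]) (add_ideal I).
Proof.
apply: min_cardP => [K L KL [A [? ? AK]]|].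
  by exists A; split=> //; exact: card_eq_trans AK KL.
pose A := range (@set1 R); exists A, A; split; last exact: card_setT_sym.
- by move=> _ [x _ <-]; exact: (ideal_set1 HI).
- move=> IA; apply: (ideal_proper HI); apply: (ideal_sub HI) IA => x _.
  by exists [set x] => //; exists x.
Qed.

Lemma add_ideal_le (A : set (set R)) : A `<=` I -> ~ I (\bigcup_(X in A) X) ->
  [set: add_ideal I] #<= A.
Proof.
move=> AI nIA; rewrite -(card_le_eqr (card_setT A)); apply: add_idealP.2.
by exists A; split=> //; exact: card_setT_sym.
Qed.

Lemma ideal_of_card_lt (A : set R) : A #< [set: non_ideal I] -> I A.
Proof.
move=> [_ nNA]; apply: contrapT => nIA; apply: nNA.
rewrite -(card_le_eqr (card_setT A)); apply: non_idealP.2.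
by exists A; split=> //; exact: card_setT_sym.
Qed.

Lemma non_ideal_range : exists2 e : non_ideal I -> R, injective e & ~ I (range e).
Proof.
have [A [nIA AN]] := non_idealP.1.
have : [set: non_ideal I] #= A by rewrite card_eq_sym.
move=> /pcard_eqP[f]; exists f; first by move=> x y /inj; rewrite !inE; exact.
by rewrite image_eq.
Qed.

End IdealCardinals.

Lemma solvability_cardinalP (R : realType) (F : set (R -> R)) :
  is_min_card (fun K => forall S, difference_system S ->
    (forall S', S' `<=` S -> S' #< [set: K] ->
       exists2 f, F f & solution S' f) ->
    exists2 f, F f & solution S f) (solvability_cardinal F).
Proof.
apply: min_cardP => [K L KL KP S Ssys sub|].
  apply: KP => // S' S'S S'K; apply: sub => //.
  by apply: card_lt_le_trans S'K _; rewrite (card_le_eql KL) card_lexx.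
(* Beyond the number of all pairs, every system is one of its own small
   subsystems. *)
exists (succ_card (((R -> R) -> (R -> R)) * (R -> R))%type) => S _ sub.
apply: sub => //; apply: card_le_lt_trans (succ_cardP _).1.
exact: card_leT.
Qed.

Section Inequalities.
Variables (R : realType) (I : set (set R)).
Hypothesis HI : ergodic_ideal I.

Lemma add_ideal_uncountable : [set: nat] #< [set: add_ideal I].
Proof.
apply/card_ltNge => addnat; have [[A [AI nIA AK]] _] := add_idealP HI.
apply: nIA; apply: (ideal_countable_bigcup HI) => //.
by apply: card_le_trans addnat; rewrite (card_le_eql AK) card_lexx.
Qed.

Lemma non_ideal_uncountable : [set: nat] #< [set: non_ideal I].
Proof.
apply/card_ltNge => nonnat; have [[A [nIA AK]] _] := non_idealP HI.
apply: nIA; apply: (ideal_countable HI).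
by apply: card_le_trans nonnat; rewrite (card_le_eql AK) card_lexx.
Qed.

(** A set outside [I] of least cardinality is the union, over a cofinal set of
    indices, of initial segments that are too small to be outside [I]. *)
Lemma add_ideal_le_cofinality_non :
  [set: add_ideal I] #<= [set: cofinality (non_ideal I)].
Proof.
have [e e_inj nIe] := non_ideal_range HI.
have [[W [A [Wini Acof AK]]] _] := cofinalityP (non_ideal I).
have Ninf : infinite_set [set: non_ideal I].
  by apply/infiniteP; case: non_ideal_uncountable.
pose P t := e @` [set s | W s t].
apply: (card_le_trans (B := P @` A)); last first.
  by apply: card_le_trans (card_image_le _ _) _; rewrite (card_le_eql AK) card_lexx.
apply: (add_ideal_le HI) => [_ [t _ <-]|IU].
  apply/(ideal_of_card_lt HI)/(card_le_lt_trans (card_image_le _ _)).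
  exact: closed_segment_lt.
apply: nIe; apply: (ideal_sub HI) IU => _ [s _ <-].
have [t At st] := Acof s; exists (P t); first by exists t.
by exists s.
Qed.

Lemma cofinality_non_lt_solvability : [set: cofinality (non_ideal I)] #<
  [set: solvability_cardinal (BI_measurable I)].
Proof.
apply/card_ltNge => sc_le.
have [e e_inj nIe] := non_ideal_range HI.
have [W Wini] := initial_well_order_exists (non_ideal I).
have [h [h_lev h_e]] := level_function_exists e W non_ideal_uncountable.
have small := ideal_of_card_lt HI.
apply: (level_system_unsolvable HI non_ideal_uncountable e_inj nIe small Wini
  h_lev h_e).
apply: (solvability_cardinalP (BI_measurable I)).1 => [_ [b _ ->]|S' S'S S'lt].
  by split=> //; exact: shift_difference_operator.
apply: (level_subsystem_solvable HI non_ideal_uncountable small Wini h_lev S'S).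
exact: card_lt_le_trans S'lt sc_le.
Qed.

Lemma ergodic_ideal_inequalities :
  [/\ [set: succ_card (cofinality (non_ideal I))]
        #<= [set: solvability_cardinal (BI_measurable I)],
      [set: succ_card (add_ideal I)]
        #<= [set: succ_card (cofinality (non_ideal I))]
    & [set: omega2] #<= [set: succ_card (add_ideal I)]].
Proof.
split.
- exact/succ_card_le/cofinality_non_lt_solvability.
- exact/succ_card_mono/add_ideal_le_cofinality_non.
- exact/succ_card_mono/succ_card_le/add_ideal_uncountable.
Qed.

End Inequalities.

(** * The null ideal *)

Section NullIdeal.
Variable R : realType.
Local Notation mu := (@lebesgue_measure R).

Lemma null_sigma_ideal : sigma_ideal (null_ideal R).
Proof.
split.
- by move=> A B AB IB; exact: negligibleS IB.
- by move=> F IF; exact: negligible_bigcup.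
- by move=> x; apply/negligibleP => //; exact: lebesgue_measure_set1.
- have muT : mu [set: R] = +oo%E by rewrite -set_itvNyy lebesgue_measure_itv.
  move=> /negligibleP => /(_ measurableT) mu0.
  by have : mu [set: R] = 0%E := mu0; rewrite muT.
Qed.

Lemma measurable_preimage_shift (a : R) (A : set R) : measurable A ->
  measurable ((fun x => x + a) @^-1` A).
Proof.
move=> mA; rewrite -[X in measurable X]setTI.
have : measurable_fun [set: R] (fun x : R => x + a) by exact: measurable_funD.
exact.
Qed.

Lemma lebesgue_measure_shift (a : R) (A : set R) : measurable A ->
  mu ((fun x => x + a) @^-1` A) = mu A.
Proof.
move=> mA; rewrite -[LHS]/(pushforward mu (fun x => x + a : measurableTypeR R) A).
have mf : measurable_fun [set: R] (fun x : R => x + a) by exact: measurable_funD.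
apply/esym/lebesgue_measure_unique => // _ [[b c]] _ <- /=.
rewrite /pushforward (_ : _ @^-1` _ = `]b - a, c - a]%classic); last first.
  by apply/seteqP; split=> x /=; rewrite !in_itv /= ltrBlDr lerBrDr.
by rewrite !lebesgue_measure_itv /= !lte_fin ltrD2r -!EFinD opprB subrKA.
Qed.

Lemma null_ideal_shift (a : R) (A : set R) :
  null_ideal R A -> null_ideal R ((fun x => x + a) @^-1` A).
Proof.
move=> [B [mB B0 AB]]; exists ((fun x => x + a) @^-1` B); split.
- exact: measurable_preimage_shift.
- by rewrite -B0; exact: lebesgue_measure_shift.
- by move=> x /AB.
Qed.

(** A rational translation close to [y - x] moves the smaller ball into the larger
    one, and moves [B] into itself up to a null set. *)
Lemma measure_ball_le_of_shift (B : set R) (x y r s : R) : measurable B ->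
  (forall q : rat, null_ideal R (B `\` (fun x => x + ratr q) @^-1` B)) ->
  r < s -> (mu (B `&` ball x r) <= mu (B `&` ball y s))%E.
Proof.
move=> mB Binv rs.
have [|q] := @rat_in_itvoo R (y - x - (s - r)) (y - x + (s - r)).
  by rewrite ltrD2l gtrN// subr_gt0.
rewrite in_itv /= => qP.
have [N [mN N0 BN]] := Binv q.
have mBs : measurable (B `&` ball y s).
  by apply: measurableI => //; exact: measurable_ball.
have mS := measurable_preimage_shift (ratr q) mBs.
apply: (@le_trans _ _ (mu (((fun x => x + ratr q) @^-1` (B `&` ball y s)) `|` N))).
  apply: le_measure; rewrite ?inE.
  - by apply: measurableI => //; exact: measurable_ball.
  - exact: measurableU.
  - move=> z [Bz xz]; have [Bzq|nBzq] := pselect (B (z + ratr q)).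
      left; split => //; move: xz; rewrite /ball /= !ltr_distl.
      by move: qP => /andP[q1 q2] /andP[z1 z2]; apply/andP; split; lra.
    by right; apply: BN.
rewrite measureU0 // le_eqVlt; apply/orP; left; apply/eqP.
exact: lebesgue_measure_shift.
Qed.

Lemma density_eventually (B : set R) (x l : R) : measurable B ->
  (mu (B `&` ball x r) * (mu (ball x r))^-1)%E @[r --> 0^'+] --> l%:E ->
  forall e : R, 0 < e -> exists2 d : R, 0 < d & forall r : R, 0 < r -> r < d ->
    ((r *+ 2 * (l - e))%:E < mu (B `&` ball x r) < (r *+ 2 * (l + e))%:E)%E.
Proof.
move=> mB /fine_cvgP[_ cvgl] e e0.
have near_l : \forall r \near 0^'+, l - e <
    fine (mu (B `&` ball x r) * (mu (ball x r))^-1)%E < l + e.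
  near=> r; apply/andP; split; near: r.
    by apply: (cvgr_gt _ cvgl); rewrite gtrBl.
  by apply: (cvgr_lt _ cvgl); rewrite ltrDl.
have [d /= d0 dP] := near_l; exists d => // r r0 rd.
have {dP} : l - e < fine (mu (B `&` ball x r) * (mu (ball x r))^-1)%E < l + e.
  by apply: dP => //=; rewrite sub0r normrN gtr0_norm.
have r2 : 0 < r *+ 2 by rewrite mulrn_wgt0.
have mball := lebesgue_measure_ball x (ltW r0).
have mfin : mu (B `&` ball x r) \is a fin_num.
  rewrite ge0_fin_numE; last exact: measure_ge0.
  apply: le_lt_trans (ltry (r *+ 2)); rewrite -mball; apply: le_measure.
  - rewrite inE; apply: measurableI => //; exact: measurable_ball.
  - rewrite inE; exact: measurable_ball.
  - exact: subIsetr.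
rewrite mball inver gt_eqF // -(fineK mfin) -EFinM /= !lte_fin.
by rewrite ltr_pdivlMr // ltr_pdivrMr // ![_ * (r *+ 2)]mulrC.
Unshelve. all: by end_near. Qed.

(** If neither [E] nor its complement is null, both have density points. The set
    fills most of every small ball about the first point, and by the previous
    comparison the ball of twice the radius about the second point contains at
    least as much of it, although the set is rare there. *)
Lemma null_ideal_ergodic (E : set R) : <<s BI_generator (null_ideal R) >> E ->
  (forall (q : rat) x, E x -> E (x + ratr q)) ->
  null_ideal R E \/ null_ideal R (~` E).
Proof.
move=> mE Einv.
have half_ball_gap (u : R) : 0 < u ->
    ~~ (u *+ 2 * (1%N%:R - 4^-1) < u *+ 2 *+ 2 * (0%N%:R + 4^-1)).
  by move=> ?; rewrite -leNgt; lra.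
have double_lt (u v : R) : 0 < v -> u <= v / 2 / 2 -> u *+ 2 < v.
  by move=> ? ?; lra.
have [B mB EB] : exists2 B, measurable B & null_ideal R (E `+` B).
  apply: (BI_generated_approx null_sigma_ideal) mE.
  - by move=> U; exact: open_measurable.
  - by move=> F mF; exact: bigcupT_measurable.
  - move=> B mB; exists (~` B); first exact: measurableC.
    by rewrite setYK; exact: negligible_set0.
have Binv (q : rat) : null_ideal R (B `\` (fun x => x + ratr q) @^-1` B).
  apply: negligibleS (negligibleU EB (null_ideal_shift (ratr q) EB)).
  move=> x [Bx nBxq]; have [Ex|nEx] := pselect (E x); last by left; right.
  by right; left; split=> //; exact: Einv.
have [Z [mZ Z0 ZP]] := lebesgue_density mB.
have nullS (A : set R) : A `<=` Z -> null_ideal R A by move=> AZ; exists Z.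
have [[x Bx nZx]|nx] := pselect (exists2 x, B x & ~ Z x); last first.
  left; have IB : null_ideal R B.
    by apply: nullS => x Bx; apply: contrapT => nZx; apply: nx; exists x.
  apply: negligibleS (negligibleU EB IB) => x Ex.
  by have [Bx|nBx] := pselect (B x); [right|left; left].
have [[y nBy nZy]|ny] := pselect (exists2 y, ~ B y & ~ Z y); last first.
  right; have IB : null_ideal R (~` B).
    by apply: nullS => y nBy; apply: contrapT => nZy; apply: ny; exists y.
  apply: negligibleS (negligibleU EB IB) => y nEy.
  by have [By|nBy] := pselect (B y); [left; right|right].
exfalso.
have dens z : ~ Z z -> (mu (B `&` ball z r) * (mu (ball z r))^-1)%E
    @[r --> 0^'+] --> (\1_B z)%:E.
  by move=> nZz; apply: contrapT => nz; apply: nZz; exact: ZP.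
(* With precision [1 / 4], the measure of [B] exceeds [3 / 2 * r] in the ball
   about [x] and is below [r] in the doubled ball about [y]. *)
have e0 : 0 < 4^-1 :> R by rewrite invr_gt0.
have [d d0 dP] := density_eventually mB (dens x nZx) e0.
have [d' d'0 d'P] := density_eventually mB (dens y nZy) e0.
pose r := Num.min d (d' / 2) / 2.
have r0 : 0 < r by rewrite divr_gt0 // lt_min d0 divr_gt0.
have rd : r < d.
  rewrite /r ltr_pdivrMr // (le_lt_trans (y := d)) ?ge_min ?lexx //.
  by rewrite ltr_pMr // ltr1n.
have rd' : r *+ 2 < d'.
  by apply: double_lt => //; rewrite ler_wpM2r ?invr_ge0 // ge_min lexx orbT.
have r2 : r < r *+ 2 by rewrite mulr2n ltrDl.
have /andP[lo _] := dP r r0 rd.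
have /andP[_ hi] := d'P _ (lt_trans r0 r2) rd'.
have := lt_trans (lt_le_trans lo (measure_ball_le_of_shift x y mB Binv r2)) hi.
rewrite lte_fin !indicE mem_set // memNset //; exact/negP/half_ball_gap.
Qed.

Lemma null_ergodic_ideal : ergodic_ideal (null_ideal R).
Proof. by split; [exact: null_sigma_ideal|exact: null_ideal_ergodic]. Qed.

End NullIdeal.

(** * The meager ideal *)

Section MeagerIdeal.
Variable R : realType.
Implicit Types A B E U : set R.

Lemma nowhere_dense_shift (a : R) A :
  nowhere_dense A -> nowhere_dense ((fun x => x + a) @^-1` A).
Proof.
move=> ndA; have shift_cont (b : R) : continuous (fun x : R => x + b).
  by move=> x; apply: cvgD; [exact: cvg_id|exact: cvg_cst].
have clS : closure ((fun x => x + a) @^-1` A) `<=` (fun x => x + a) @^-1` closure A.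
  rewrite [X in X `<=` _]closureE; apply: smallest_sub; last first.
    by move=> x /=; exact: (@subset_closure _ A).
  by apply: closed_comp (@closed_closure _ A) => x _; exact: shift_cont.
apply/seteqP; split=> // x xin.
pose O := (fun x => x + - a) @^-1` (closure ((fun x => x + a) @^-1` A))°.
have oO : open O.
  by apply: open_comp (open_interior _) => y _; exact: shift_cont.
suff : (closure A)° (x + a) by rewrite ndA.
have OA : O `<=` closure A.
  by move=> y /interior_subset /clS /=; rewrite subrK.
by move: OA; rewrite (open_subsetE _ oO); apply; rewrite /O /= addrK; exact: xin.
Qed.

Lemma meager_ideal_shift (a : R) A :
  meager_ideal R A -> meager_ideal R ((fun x => x + a) @^-1` A).
Proof.
move=> [F [ndF AF]]; exists (fun n => (fun x => x + a) @^-1` F n); split.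
  by move=> n; exact: nowhere_dense_shift.
by move=> x /AF[n _ Fx]; exists n.
Qed.

Lemma nowhere_dense_meager A : nowhere_dense A -> meager_ideal R A.
Proof. by move=> ndA; exists (fun=> A); split=> // x Ax; exists 0%N. Qed.

Lemma closed_nowhere_dense A : closed A -> A° `<=` set0 -> nowhere_dense A.
Proof.
by move=> cA A0; rewrite /nowhere_dense -(closure_id A).1 //; apply/seteqP; split.
Qed.

Lemma meager_sigma_ideal : sigma_ideal (meager_ideal R).
Proof.
split.
- move=> A B AB [F [ndF BF]]; exists F; split=> //; exact: subset_trans BF.
- move=> A /choice[F FP].
  have nd0 : nowhere_dense (@set0 R).
    by apply: closed_nowhere_dense closed0 _ => x /interior_subset.
  exists (fun k => if unpickle k is Some (n, m) then F n m else set0); split.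
    by move=> k; case: (unpickle k) => [[n m]|//]; exact: (FP n).1.
  move=> x [n _ /(FP n).2[m _ Fx]]; exists (pickle (n, m)) => //.
  by rewrite pickleK.
- move=> x; apply/nowhere_dense_meager/closed_nowhere_dense.
    exact/accessible_closed_set1/hausdorff_accessible/Rhausdorff.
  move=> y yin; have yx : y = x := interior_subset yin.
  have : ([set x]° `&` ~` [set x]) !=set0.
    by apply: dense_set1C; [exists y|exact: open_interior].
  by move=> [z [/interior_subset]].
- move=> [F [ndF RF]].
  have [|||z [_ zP]] := @Baire R R (fun n => ~` closure (F n)) _ setT.
  - move=> n; split; first exact/closed_openC/closed_closure.
    move=> O [y Oy] oO; apply: contrapT => nO.
    have : (closure (F n))° y; last by rewrite ndF.
    have: O `<=` closure (F n); last by rewrite (open_subsetE _ oO); exact.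
    move=> z Oz; apply: contrapT => nz.
    by apply: nO; exists z.
  - by exists 0.
  - exact: openT.
  - by have [n _ Fz] := RF z I; apply: (zP n I); exact: subset_closure.
Qed.

(** A set with the Baire property that is almost a nonempty open set [U] and is
    rationally invariant is conull: every point is moved into [U] by a
    rational. *)
Lemma meager_ideal_ergodic E : <<s BI_generator (meager_ideal R) >> E ->
  (forall (q : rat) x, E x -> E (x + ratr q)) ->
  meager_ideal R E \/ meager_ideal R (~` E).
Proof.
move=> mE Einv.
have [U oU EU] : exists2 U, open U & meager_ideal R (E `+` U).
  apply: (BI_generated_approx meager_sigma_ideal) mE => // [F oF|B oB].
    exact: bigcup_open.
  exists (~` B)°; first exact: open_interior.
  have -> : ~` B `+` (~` B)° = ~` B `&` ~` (~` B)°.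
    rewrite setY_def setDE (_ : _ `\` ~` B = set0) ?setU0 //.
    by apply/seteqP; split=> // x [/interior_subset].
  apply/nowhere_dense_meager/closed_nowhere_dense.
    by apply: closedI; apply: open_closedC => //; exact: open_interior.
  move=> x xin; have [_ nx] := interior_subset xin.
  by apply: nx; apply: interiorS xin => y [].
have [[y Uy]|U0] := pselect (U !=set0); last first.
  left; apply: (ideal_sub meager_sigma_ideal) EU => x Ex; left; split=> // Ux.
  by apply: U0; exists x.
right; apply: (ideal_sub meager_sigma_ideal) (ideal_countable_bigcup
  meager_sigma_ideal (countableP [set: rat])
  (fun q _ => meager_ideal_shift (ratr q) EU)) => z nEz.
have [w [[q _ <-] wU]] : exists w, (range (@ratr R) w) /\ U (z + w).
  have [||w [Uw qw]] := @dense_rat R ((fun w => z + w) @^-1` U).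
  - by exists (y - z); rewrite /= addrC subrK.
  - apply: open_comp oU => w _.
    by apply: cvgD; [exact: cvg_cst|exact: cvg_id].
  - by exists w.
exists q => //; right; split=> // Ezq; apply: nEz.
by have := Einv (- q) _ Ezq; rewrite rmorphN addrK.
Qed.

Lemma meager_ergodic_ideal : ergodic_ideal (meager_ideal R).
Proof. by split; [exact: meager_sigma_ideal|exact: meager_ideal_ergodic]. Qed.

End MeagerIdeal.

(** * The inequalities for null and meager sets *)

Theorem theorem8p7 (R : realType) (I : set (set R))
    (hI : I = null_ideal R \/ I = meager_ideal R) :
  [/\ [set: succ_card (cofinality (non_ideal I))]
        #<= [set: solvability_cardinal (BI_measurable I)],
      [set: succ_card (add_ideal I)]
        #<= [set: succ_card (cofinality (non_ideal I))]
    & [set: omega2] #<= [set: succ_card (add_ideal I)]].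
Proof.
apply: ergodic_ideal_inequalities; case: hI => ->.
- exact: null_ergodic_ideal.
- exact: meager_ergodic_ideal.
Qed.
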